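(* Let $F$ be a random function from $\mathbb{T}^2$ into $\mathbb{R}^2$ belonging to $H(\mathrm{div};\mathbb{T}^2)$, and let $\mathcal{P}$ be the (unweighted) projection onto gradient vector fields. Then the variance of $\mathcal{P}(F)$ is smaller than the variance of $F$: $$\int_{\mathbb{T}^2}\mathrm{Var}(\mathcal{P}(F))\le\int_{\mathbb{T}^2}\mathrm{Var}(F),$$ where, for any random vector field $F$, $\mathrm{Var}(F)=\mathbb{E}(|F|^2)-|\mathbb{E}(F)|^2$ (pointwise on $\mathbb{T}^2$) and $|\cdot|$ is the Euclidean norm.
   Context: $\mathbb{T}=\mathbb{R}/\mathbb{Z}$. $H(\mathrm{div};\mathbb{T}^2)=\{g\in L^2(\mathbb{T}^2)\times L^2(\mathbb{T}^2):\ \mathrm{div}\,g\in L^2(\mathbb{T}^2)\}$. $H^1(\mathbb{T}^2)/\mathbb{R}=\{g\in H^1(\mathbb{T}^2):\int_{\mathbb{T}^2}g=0\}$. For $F\in H(\mathrm{div};\mathbb{T}^2)$, $\mathcal{P}(F)=\nabla A$, where $A$ is the unique element of $H^1(\mathbb{T}^2)/\mathbb{R}$ such that $\int_{\mathbb{T}^2}\nabla A\cdot\nabla g=\int_{\mathbb{T}^2}F\cdot\nabla g$ for all $g\in H^1(\mathbb{T}^2)/\mathbb{R}$ (equivalently, $A$ minimizes $\int_{\mathbb{T}^2}|\nabla h-F|^2$ over $h\in H^1(\mathbb{T}^2)/\mathbb{R}$). The random field $F$ is implicitly assumed to have the finite second moments needed for the expectations and variances to be defined. *)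

(* Defs.v *)
From HB Require Import structures.
From mathcomp Require Import all_boot all_order all_algebra.
From mathcomp Require Import all_classical all_reals all_analysis.

Set Implicit Arguments.
Unset Strict Implicit.
Unset Printing Implicit Defensive.

Import Order.TTheory GRing.Theory Num.Theory.
Import numFieldNormedType.Exports.

Local Open Scope classical_set_scope.
Local Open Scope ring_scope.

(* A function on the torus (R/Z)^2 is represented by a function on R * R that
   is invariant under translation by the generators of Z^2. *)
Definition torus_periodic (R : realType) (V : zmodType) (f : R * R -> V) : Prop :=
  periodic f (1, 0) /\ periodic f (0, 1).

Definition unit_cell (R : realType) : set (R * R) := `[0, 1[ `*` `[0, 1[.

Arguments unit_cell R : clear implicits.

Lemma measurable_unit_cell (R : realType) :
  measurable (unit_cell R : set (measurableTypeR R * measurableTypeR R)).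
Proof. by apply: measurableX; exact: measurable_itv. Qed.

(* Haar measure of the torus, as Lebesgue measure on a fundamental domain. *)
Definition torus_measure (R : realType) :
    {measure set (measurableTypeR R * measurableTypeR R) -> \bar R} :=
  mrestr (lebesgue_measure \x lebesgue_measure)%E (@measurable_unit_cell R).

Definition torus_L2 (R : realType) (f : R * R -> R) : Prop :=
  torus_periodic f /\ f \in Lfun (torus_measure R) 2%:E.

(* The product norm of [R * R] in the library is the sup norm, so the Euclidean
   structure is spelled out. *)
Definition dot (R : realType) (u v : R * R) : R := u.1 * v.1 + u.2 * v.2.

Definition enorm (R : realType) (u : R * R) : R := Num.sqrt (dot u u).

Definition torus_L2_field (R : realType) (G : R * R -> R * R) : Prop :=
  torus_L2 (fun x => (G x).1) /\ torus_L2 (fun x => (G x).2).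

Definition grad (R : realType) (f : R * R -> R) (x : R * R) : R * R :=
  ('D_(1, 0) f x, 'D_(0, 1) f x).

Fixpoint Cn (R : realType) (n : nat) (f : R * R -> R) : Prop :=
  continuous f /\
  if n is m.+1 then
    [/\ forall x, derivable f x (1, 0), forall x, derivable f x (0, 1),
        Cn m ('D_(1, 0) f) & Cn m ('D_(0, 1) f)]
  else True.

Definition test_function (R : realType) (phi : R * R -> R) : Prop :=
  torus_periodic phi /\ forall n, Cn n phi.

Definition is_weak_div (R : realType) (G : R * R -> R * R)
    (h : R * R -> R) : Prop :=
  forall phi, test_function phi ->
    \int[torus_measure R]_x (dot (G x) (grad phi x))
    = - \int[torus_measure R]_x (h x * phi x).

Definition is_weak_grad (R : realType) (g : R * R -> R)
    (G : R * R -> R * R) : Prop :=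
  forall phi, test_function phi ->
    (\int[torus_measure R]_x (g x * (grad phi x).1)
       = - \int[torus_measure R]_x ((G x).1 * phi x)) /\
    (\int[torus_measure R]_x (g x * (grad phi x).2)
       = - \int[torus_measure R]_x ((G x).2 * phi x)).

Definition Hdiv (R : realType) (G : R * R -> R * R) : Prop :=
  torus_L2_field G /\ exists2 h, torus_L2 h & is_weak_div G h.

(* [H1_mean0 g G]: g lies in H^1(T^2)/R and G represents its gradient, which is
   only determined almost everywhere. *)
Definition H1_mean0 (R : realType) (g : R * R -> R)
    (G : R * R -> R * R) : Prop :=
  [/\ torus_L2 g, torus_L2_field G, is_weak_grad g G
    & \int[torus_measure R]_x g x = 0].

(* [is_grad_projection F G]: G is a representative of the gradient projection of
   F. It is a relation because the projection is an element of L^2, so that its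
   representatives are only determined almost everywhere. *)
Definition is_grad_projection (R : realType) (F G : R * R -> R * R) : Prop :=
  exists2 A, H1_mean0 A G &
    forall g Dg, H1_mean0 g Dg ->
      \int[torus_measure R]_x dot (G x) (Dg x)
      = \int[torus_measure R]_x dot (F x) (Dg x).

(* Measurability in the pair (w, x): it makes the pointwise expectation
   meaningful for almost every x although each F w only stands for a class of
   functions modulo null sets. *)
Definition jointly_measurable d (Omega : measurableType d) (R : realType)
    (F : Omega -> R * R -> R * R) : Prop :=
  measurable_fun setT
    (fun z : Omega * (measurableTypeR R * measurableTypeR R) =>
       F z.1 z.2 : measurableTypeR R * measurableTypeR R).

(* [fine] is harmless where the second moment of [F ^~ x] is finite, since the
   two expectations are then finite. *)
Definition mean_field d (Omega : measurableType d) (R : realType)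
    (P : probability Omega R) (F : Omega -> R * R -> R * R) (x : R * R) : R * R :=
  (fine 'E_P[fun w => (F w x).1], fine 'E_P[fun w => (F w x).2])%E.

Definition var_field d (Omega : measurableType d) (R : realType)
    (P : probability Omega R) (F : Omega -> R * R -> R * R) (x : R * R) : \bar R :=
  ('E_P[(fun w => enorm (F w x) ^+ 2)%R] - (enorm (mean_field P F x) ^+ 2)%:E)%E.

(* Main.v *)
Require Import Defs.
From HB Require Import structures.
From mathcomp Require Import all_boot all_order all_algebra.
From mathcomp Require Import all_classical all_reals all_analysis.
From mathcomp Require Import measurable_realfun ring lra.

Set Implicit Arguments.
Unset Strict Implicit.
Unset Printing Implicit Defensive.

Import Order.TTheory GRing.Theory Num.Theory.
Import numFieldNormedType.Exports.

Local Open Scope classical_set_scope.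
Local Open Scope ring_scope.

(** The variance of a random vector is half the mean squared distance between
    the vector and an independent copy of it.  Integrated over the torus and
    with the integrals exchanged, this reads
      [int Var(F) = E_w E_w' [(1/2) ||F w - F w'||^2]],
    with the L^2 norm on the right ([total_var_indep_copy]).  The mean
    fields have disappeared, so the claim reduces to a deterministic one about
    pairs of realizations: for almost all [w] and [w'], the projections of [F w]
    and [F w'] are at most as far apart in L^2 as [F w] and [F w'] are
    ([grad_projection_contraction]).

    That contraction is Hilbert space geometry.  If [G] and [G'] are the
    projections of [F] and [F'], then [G] and [G'] are both admissible test
    gradients in both variational identities; combining the four instances
    yields [<F - F', G - G'> = ||G - G'||^2], and expanding
    [0 <= ||(F - F') - (G - G')||^2] gives [||G - G'||^2 <= ||F - F'||^2].

    All integrands are nonnegative, so Tonelli's theorem and the monotonicity of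
    the integral apply even where the integrals are infinite; in particular the
    independent-copy formula is proved in the extended reals, also for a
    variable whose second moment is infinite. *)

(** * Variance through an independent copy *)

Lemma integral_quadratic (R : realType) (d : measure_display)
    (Omega : measurableType d) (P : probability Omega R) (X : Omega -> R)
    (a b c : R) :
  P.-integrable setT (EFin \o X) ->
  P.-integrable setT (EFin \o (fun w => X w ^+ 2)) ->
  (\int[P]_w (a + b * X w + c * X w ^+ 2)%:E
   = (a + b * \int[P]_w X w + c * \int[P]_w (X w ^+ 2))%:E)%E.
Proof.
move=> iX iX2.
have ia : P.-integrable setT (EFin \o cst a).
  exact: finite_measure_integrable_cst.
have ib : P.-integrable setT (EFin \o (fun w => b * X w)).
  by have := integrableZl measurableT b iX.
have ic : P.-integrable setT (EFin \o (fun w => c * X w ^+ 2)).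
  by have := integrableZl measurableT c iX2.
have iab : P.-integrable setT (EFin \o (fun w => a + b * X w)).
  exact: (integrableD measurableT ia ib).
have iabc : P.-integrable setT (EFin \o (fun w => a + b * X w + c * X w ^+ 2)).
  exact: (integrableD measurableT iab ic).
rewrite -[LHS]fineK; last exact: (integrable_fin_num measurableT iabc).
rewrite -/(Rintegral P setT (fun w => a + b * X w + c * X w ^+ 2)).
rewrite (RintegralD measurableT iab ic) (RintegralD measurableT ia ib).
rewrite !RintegralZl// Rintegral_cst//.
by rewrite [X in a * X](congr1 fine (probability_setT P)) mulr1.
Qed.

Lemma integrable_of_sqr (R : realType) (d : measure_display)
    (Omega : measurableType d) (P : probability Omega R) (X : Omega -> R) :
  measurable_fun setT X ->
  P.-integrable setT (EFin \o (fun w => X w ^+ 2)) ->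
  P.-integrable setT (EFin \o X).
Proof.
move=> mX iX2.
have i1 : P.-integrable setT (EFin \o cst (1 : R)).
  exact: finite_measure_integrable_cst.
apply: (le_integrable measurableT _ _ (integrableD measurableT i1 iX2)).
  by apply/measurable_EFinP.
move=> w _ /=; rewrite lee_fin [leRHS]ger0_norm ?addr_ge0 ?sqr_ge0//.
rewrite ler_norml; apply/andP; split; nra.
Qed.

(** With a finite second moment, expanding the square gives
    [(M - 2 m^2 + M) / 2 = M - m^2].  With an infinite second moment, no
    translate [X - X w] is square integrable, so both sides are infinite
    whatever finite value [fine] gives to the mean.  The second case is there
    for the projected field: it is square integrable in space for almost every
    [w], which does not bound its second moment at a given point. *)
Lemma variance_indep_copy (R : realType) (d : measure_display)
    (Omega : measurableType d) (P : probability Omega R) (X : Omega -> R) :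
  measurable_fun setT X ->
  (\int[P]_w ((X w ^+ 2)%:E) - ((fine (\int[P]_w (X w)%:E)) ^+ 2)%:E
   = \int[P]_w \int[P]_w' ((X w - X w') ^+ 2 / 2)%:E)%E.
Proof.
move=> mX.
have mX2 : measurable_fun setT (fun w => (X w ^+ 2)%:E).
  by apply/measurable_EFinP; exact: measurable_funX.
have [oo|fin] := eqVneq (\int[P]_w ((X w ^+ 2)%:E))%E +oo%E.
  have inner w : (\int[P]_w' ((X w - X w') ^+ 2 / 2)%:E = +oo)%E.
    have mI : measurable_fun setT (fun w' => ((X w - X w') ^+ 2 / 2)%:E).
      apply/measurable_EFinP; apply: measurable_funM => //.
      by apply: measurable_funX; exact: measurable_funB.
    (* [b^2 <= 2 (a - b)^2 + 2 a^2]: if the integral of [(X w - X w')^2] were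
       finite, so would be the second moment. *)
    have : (\int[P]_w' ((X w' ^+ 2)%:E) <=
      \int[P]_w' (4%:E * ((X w - X w') ^+ 2 / 2)%:E + (2 * X w ^+ 2)%:E))%E.
      apply: ge0_le_integral => //.
      - by move=> w' _; rewrite lee_fin sqr_ge0.
      - apply: emeasurable_funD => //.
        exact: measurable_funeM.
      - move=> w' _; rewrite -EFinM -EFinD lee_fin.
        by have := sqr_ge0 (2 * X w - X w'); nra.
    rewrite oo ge0_integralD//; last 3 first.
    - by move=> w' _; rewrite -EFinM lee_fin; have := sqr_ge0 (X w - X w'); nra.
    - exact: measurable_funeM.
    - by move=> w' _; rewrite lee_fin mulr_ge0// sqr_ge0.
    rewrite ge0_integralZl_EFin//; last first.
      by move=> w' _; rewrite lee_fin divr_ge0// sqr_ge0.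
    rewrite integral_cst// [X in (_ + _ * X)%E]probability_setT mule1.
    rewrite leye_eq => /eqP.
    case: (\int[P]_w' _)%E => [r| |]//.
    by rewrite gt0_muleNy ?lte_fin.
  under [RHS]eq_integral do rewrite inner.
  by rewrite oo integral_cst// [X in (_ * X)%E]probability_setT mule1 addye.
have iX2 : P.-integrable setT (EFin \o (fun w => X w ^+ 2)).
  apply/integrableP; split=> //; under eq_integral do
    rewrite /= ger0_norm ?sqr_ge0//.
  by rewrite lt_neqAle fin leey.
have iX := integrable_of_sqr mX iX2.
pose m := \int[P]_w X w; pose M := \int[P]_w (X w ^+ 2).
have inner w : (\int[P]_w' ((X w - X w') ^+ 2 / 2)%:E
    = (2^-1 * M + - m * X w + 2^-1 * X w ^+ 2)%:E)%E.
  rewrite (_ : 2^-1 * M + - m * X w + 2^-1 * X w ^+ 2 =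
    X w ^+ 2 / 2 + - X w * m + 2^-1 * M); last by rewrite /m /M; field.
  rewrite -integral_quadratic//.
  by apply: eq_integral => w' _; congr (_%:E); field.
under [RHS]eq_integral do rewrite inner.
rewrite integral_quadratic// -/m -/M -[X in (X - _)%E]fineK;
  last exact: (integrable_fin_num measurableT iX2).
by rewrite -EFinB; congr (_%:E); transitivity (M - m ^+ 2) => //; field.
Qed.

(** * Orthogonal projections contract distances *)

Section projection_contraction.
Context (R : realType) (d : measure_display) (T : measurableType d).
Variable mu : {measure set T -> \bar R}.

Definition L2_field (F : T -> R * R) : Prop :=
  (fun x => (F x).1) \in Lfun mu 2%:E /\ (fun x => (F x).2) \in Lfun mu 2%:E.

Definition L2dot (F G : T -> R * R) : R := \int[mu]_x dot (F x) (G x).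

Lemma Lfun2B (f g : T -> R) :
  f \in Lfun mu 2%:E -> g \in Lfun mu 2%:E ->
  (fun x => f x - g x) \in Lfun mu 2%:E.
Proof.
move=> f2 g2; have p1 : (1 <= 2%:E :> \bar R)%E by rewrite lee_fin ler1n.
have -> : (fun x => f x - g x) = -1 *: (g : T -> R) + f.
  by apply/funext => x; rewrite scaleN1r addrC.
exact: (Lfun_submod_closed mu p1).2.
Qed.

Lemma L2_fieldB F G : L2_field F -> L2_field G ->
  L2_field (fun x => F x - G x).
Proof. by move=> [F1 F2] [G1 G2]; split; exact: Lfun2B. Qed.

Lemma integrable_dot F G : L2_field F -> L2_field G ->
  mu.-integrable setT (EFin \o (fun x => dot (F x) (G x))).
Proof.
move=> [F1 F2] [G1 G2].
have i1 := Lfun2_mul_Lfun1 F1 G1; have i2 := Lfun2_mul_Lfun1 F2 G2.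
exact: (integrableD measurableT ((Lfun1_integrable _ _).1 i1)
                                ((Lfun1_integrable _ _).1 i2)).
Qed.

Lemma L2dotC F G : L2dot F G = L2dot G F.
Proof. by apply: eq_Rintegral => x _; rewrite /dot mulrC [X in _ + X]mulrC. Qed.

Lemma L2dotBl F G H : L2_field F -> L2_field G -> L2_field H ->
  L2dot (fun x => F x - G x) H = L2dot F H - L2dot G H.
Proof.
move=> F2 G2 H2; rewrite /L2dot -RintegralB//; try exact: integrable_dot.
by apply: eq_Rintegral => x _; rewrite /dot /=; ring.
Qed.

Lemma L2dotBr F G H : L2_field F -> L2_field G -> L2_field H ->
  L2dot H (fun x => F x - G x) = L2dot H F - L2dot H G.
Proof. by move=> F2 G2 H2; rewrite L2dotC L2dotBl// ![L2dot _ H]L2dotC. Qed.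

Lemma L2dot_sqB F G : L2_field F -> L2_field G ->
  L2dot (fun x => F x - G x) (fun x => F x - G x)
  = L2dot F F - 2 * L2dot F G + L2dot G G.
Proof.
move=> F2 G2; have FG2 := L2_fieldB F2 G2.
by rewrite L2dotBl// !L2dotBr// (L2dotC G F); ring.
Qed.

Lemma L2dot_ge0 F : 0 <= L2dot F F.
Proof.
by apply: Rintegral_ge0 => x _; rewrite /dot -!expr2 addr_ge0 ?sqr_ge0.
Qed.

(** The four equations say that each residual [F - G], [F' - G'] is orthogonal
    to both [G] and [G'], as it is for orthogonal projections on a space that
    contains [G] and [G'].  Hence [G - G'] is the orthogonal projection of
    [F - F'] on the span of [G] and [G']. *)
Lemma projection_contraction F F' G G' :
  L2_field F -> L2_field F' -> L2_field G -> L2_field G' ->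
  L2dot G G = L2dot F G -> L2dot G G' = L2dot F G' ->
  L2dot G' G = L2dot F' G -> L2dot G' G' = L2dot F' G' ->
  L2dot (fun x => G x - G' x) (fun x => G x - G' x)
    <= L2dot (fun x => F x - F' x) (fun x => F x - F' x).
Proof.
move=> F2 F'2 G2 G'2 GG GG' G'G G'G'.
have D2 := L2_fieldB F2 F'2; have E2 := L2_fieldB G2 G'2.
have DE : L2dot (fun x => F x - F' x) (fun x => G x - G' x)
        = L2dot (fun x => G x - G' x) (fun x => G x - G' x).
  by rewrite !L2dotBl// !L2dotBr// GG GG' G'G G'G'.
have := L2dot_ge0 (fun x => (F x - F' x) - (G x - G' x)).
rewrite L2dot_sqB// DE; lra.
Qed.

End projection_contraction.

(** * Exchanging the expectation and the integral over the torus *)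

Lemma tonelli_indep_copy (R : realType) (d d' : measure_display)
    (T : measurableType d) (Omega : measurableType d')
    (mu : {sigma_finite_measure set T -> \bar R}) (P : probability Omega R)
    (h : Omega -> Omega -> T -> \bar R) :
  measurable_fun setT (fun z : T * Omega * Omega => h z.1.2 z.2 z.1.1) ->
  (forall w w' x, 0 <= h w w' x)%E ->
  (\int[mu]_x \int[P]_w \int[P]_w' h w w' x
   = \int[P]_w \int[P]_w' \int[mu]_x h w w' x)%E.
Proof.
move=> mh h0.
rewrite (fubini_tonelli (fun z : T * Omega => \int[P]_w' h z.2 w' z.1)%E) /=.
- apply: eq_integral => w _.
  rewrite (fubini_tonelli (fun z : T * Omega => h w z.2 z.1))//=.
  have mr : measurable_fun setT (fun z : T * Omega => (z.1, w, z.2)).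
    apply: measurable_fun_pair; last exact: measurable_snd.
    apply: measurable_fun_pair; first exact: measurable_fst.
    exact: measurable_cst.
  exact: (measurableT_comp mh mr).
- exact: (measurable_fun_fubini_tonelli_F (m2 := P) _ mh).
- by move=> z; exact: integral_ge0.
Qed.

Lemma unit_cell_lty (R : realType) :
  ((lebesgue_measure \x lebesgue_measure) (unit_cell R) < +oo)%E.
Proof.
rewrite product_measure1E ?lebesgue_measure_itv//=; [|exact: measurable_itv..].
by rewrite !lebesgue_measure_itv /= lte_fin ltr01 -EFinB -EFinM ltry.
Qed.

(** The measure [torus_measure R], repackaged so that its finiteness, and hence
    the sigma-finiteness that Tonelli's theorem asks for, can be inferred; the
    two are convertible. *)
Definition torus_finite_measure (R : realType) :
    {finite_measure set (measurableTypeR R * measurableTypeR R)%type -> \bar R} :=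
  mfrestr (@measurable_unit_cell R) (@unit_cell_lty R).

(** * The variance of a random field *)

(** The factor 1/2 of the independent-copy formula is kept inside the integrand,
    so that it never has to be moved through extended-real integrals. *)
Definition half_sqdist (R : realType) (u v : R * R) : R :=
  dot (u - v) (u - v) / 2.

Lemma half_sqdist_ge0 (R : realType) (u v : R * R) : 0 <= half_sqdist u v.
Proof. by rewrite /half_sqdist /dot -!expr2 divr_ge0// addr_ge0// sqr_ge0. Qed.

Lemma measurable_half_sqdist (R : realType) (d : measure_display)
    (T : measurableType d)
    (f g : T -> (measurableTypeR R * measurableTypeR R)%type) :
  measurable_fun setT f -> measurable_fun setT g ->
  measurable_fun setT (fun z => (half_sqdist (f z) (g z))%:E).
Proof.
move=> mf mg; apply/measurable_EFinP; apply: measurable_funM => //.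
have m1 : measurable_fun setT (fun z => (f z).1 - (g z).1 : R).
  by apply: measurable_funB; exact: (measurableT_comp measurable_fst).
have m2 : measurable_fun setT (fun z => (f z).2 - (g z).2 : R).
  by apply: measurable_funB; exact: (measurableT_comp measurable_snd).
by apply: measurable_funD; apply: measurable_funM.
Qed.

Section random_field.
Context (R : realType) (d : measure_display) (Omega : measurableType d).
Variable P : probability Omega R.

(** The Euclidean norm makes the variance of a vector the sum of the variances
    of its two components. *)
Lemma var_field_indep_copy (F : Omega -> R * R -> R * R) (x : R * R) :
  jointly_measurable F ->
  var_field P F x
  = (\int[P]_w \int[P]_w' (half_sqdist (F w x) (F w' x))%:E)%E.
Proof.
move=> mF.
have mFx : measurable_fun setT
    (fun w => F w x : measurableTypeR R * measurableTypeR R).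
  exact: (measurableT_comp mF (pair2_measurable x)).
have m1 : measurable_fun setT (fun w => (F w x).1 : R).
  exact: (measurableT_comp measurable_fst mFx).
have m2 : measurable_fun setT (fun w => (F w x).2 : R).
  exact: (measurableT_comp measurable_snd mFx).
have sq (f : Omega -> R) : measurable_fun setT f ->
    measurable_fun setT (fun w => (f w ^+ 2)%:E).
  by move=> mf; apply/measurable_EFinP; exact: measurable_funX.
have sqB (f : Omega -> R) : measurable_fun setT f ->
    measurable_fun setT (fun z : Omega * Omega => ((f z.1 - f z.2) ^+ 2 / 2)%:E).
  move=> mf; apply/measurable_EFinP; apply: measurable_funM => //.
  apply: measurable_funX; apply: measurable_funB.
  - exact: (measurableT_comp mf measurable_fst).
  - exact: (measurableT_comp mf measurable_snd).
have sqB0 (a b : R) : (0 <= ((a - b) ^+ 2 / 2)%:E)%E.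
  by rewrite lee_fin divr_ge0// sqr_ge0.
have enormE u : enorm u ^+ 2 = u.1 ^+ 2 + u.2 ^+ 2 :> R.
  by rewrite sqr_sqrtr /dot -!expr2// addr_ge0 ?sqr_ge0.
rewrite /var_field enormE /mean_field unlock /=.
under eq_integral do rewrite enormE EFinD.
rewrite ge0_integralD//; [|by move=> w _; rewrite lee_fin sqr_ge0|exact: sq
  |by move=> w _; rewrite lee_fin sqr_ge0|exact: sq].
rewrite opprD EFinD addeACA !variance_indep_copy//.
have inner w : (\int[P]_w' (half_sqdist (F w x) (F w' x))%:E
    = \int[P]_w' (((F w x).1 - (F w' x).1) ^+ 2 / 2)%:E
      + \int[P]_w' (((F w x).2 - (F w' x).2) ^+ 2 / 2)%:E)%E.
  rewrite -ge0_integralD//.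
  - by apply: eq_integral => w' _; rewrite /half_sqdist /dot -!expr2 mulrDl.
  - exact: (measurableT_comp (sqB _ m1) (pair1_measurable w)).
  - exact: (measurableT_comp (sqB _ m2) (pair1_measurable w)).
under [RHS]eq_integral do rewrite inner.
rewrite [RHS]ge0_integralD//.
- by move=> w _; exact: integral_ge0.
- exact: (measurable_fun_fubini_tonelli_F (m2 := P) _ (sqB _ m1)).
- by move=> w _; exact: integral_ge0.
- exact: (measurable_fun_fubini_tonelli_F (m2 := P) _ (sqB _ m2)).
Qed.

Lemma total_var_indep_copy (F : Omega -> R * R -> R * R) :
  jointly_measurable F ->
  (\int[torus_measure R]_x var_field P F x
   = \int[P]_w \int[P]_w' \int[torus_measure R]_x
       (half_sqdist (F w x) (F w' x))%:E)%E.
Proof.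
move=> mF.
under eq_integral do rewrite var_field_indep_copy//.
have mh : measurable_fun setT (fun z :
    (measurableTypeR R * measurableTypeR R) * Omega * Omega =>
    (half_sqdist (F z.1.2 z.1.1) (F z.2 z.1.1))%:E).
  apply: measurable_half_sqdist.
  - have mr : measurable_fun setT (fun z :
        (measurableTypeR R * measurableTypeR R) * Omega * Omega =>
        (z.1.2, z.1.1)).
      apply: measurable_fun_pair.
      + exact: (measurableT_comp measurable_snd measurable_fst).
      + exact: (measurableT_comp measurable_fst measurable_fst).
    exact: (measurableT_comp mF mr).
  - have mr : measurable_fun setT (fun z :
        (measurableTypeR R * measurableTypeR R) * Omega * Omega =>
        (z.2, z.1.1)).
      apply: measurable_fun_pair; first exact: measurable_snd.
      exact: (measurableT_comp measurable_fst measurable_fst).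
    exact: (measurableT_comp mF mr).
have h0 w w' x : (0 <= (half_sqdist (F w x) (F w' x))%:E)%E.
  by rewrite lee_fin half_sqdist_ge0.
exact: (tonelli_indep_copy (torus_finite_measure R) P mh h0).
Qed.

Lemma measurable_integral_half_sqdist (F : Omega -> R * R -> R * R) :
  jointly_measurable F ->
  measurable_fun setT (fun z : Omega * Omega =>
    \int[torus_measure R]_x (half_sqdist (F z.1 x) (F z.2 x))%:E)%E.
Proof.
move=> mF.
have mh : measurable_fun setT (fun z :
    Omega * Omega * (measurableTypeR R * measurableTypeR R) =>
    (half_sqdist (F z.1.1 z.2) (F z.1.2 z.2))%:E).
  apply: measurable_half_sqdist.
  - have mr : measurable_fun setT (fun z :
        Omega * Omega * (measurableTypeR R * measurableTypeR R) =>
        (z.1.1, z.2)).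
      apply: measurable_fun_pair; last exact: measurable_snd.
      exact: (measurableT_comp measurable_fst measurable_fst).
    exact: (measurableT_comp mF mr).
  - have mr : measurable_fun setT (fun z :
        Omega * Omega * (measurableTypeR R * measurableTypeR R) =>
        (z.1.2, z.2)).
      apply: measurable_fun_pair; last exact: measurable_snd.
      exact: (measurableT_comp measurable_snd measurable_fst).
    exact: (measurableT_comp mF mr).
have h0 z : (0 <= (half_sqdist (F z.1.1 z.2) (F z.1.2 z.2))%:E)%E.
  by rewrite lee_fin half_sqdist_ge0.
exact: (measurable_fun_fubini_tonelli_F (m2 := torus_finite_measure R) _ mh h0).
Qed.

End random_field.

(** * The gradient projection *)

Lemma torus_L2_field_L2 (R : realType) (F : R * R -> R * R) :
  torus_L2_field F -> L2_field (torus_measure R) F.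
Proof. by move=> [[_ F1] [_ F2]]. Qed.

Lemma integral_half_sqdist (R : realType) (d : measure_display)
    (T : measurableType d) (mu : {measure set T -> \bar R})
    (F G : T -> R * R) :
  L2_field mu F -> L2_field mu G ->
  (\int[mu]_x (half_sqdist (F x) (G x))%:E
   = (L2dot mu (fun x => F x - G x)%R (fun x => F x - G x)%R / 2)%:E)%E.
Proof.
move=> F2 G2; have FG2 := L2_fieldB F2 G2; have iFG := integrable_dot FG2 FG2.
rewrite /L2dot -(RintegralZr _ measurableT iFG) [RHS]fineK//.
exact: (integrable_fin_num measurableT (integrableZr measurableT _ iFG)).
Qed.

Lemma grad_projection_contraction (R : realType) (F F' G G' : R * R -> R * R) :
  Hdiv F -> Hdiv F' -> is_grad_projection F G -> is_grad_projection F' G' ->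
  (\int[torus_measure R]_x (half_sqdist (G x) (G' x))%:E
   <= \int[torus_measure R]_x (half_sqdist (F x) (F' x))%:E)%E.
Proof.
move=> [/torus_L2_field_L2 F2 _] [/torus_L2_field_L2 F'2 _].
move=> [A AG FG] [A' A'G' F'G'].
have [_ /torus_L2_field_L2 G2 _ _] := AG.
have [_ /torus_L2_field_L2 G'2 _ _] := A'G'.
rewrite !integral_half_sqdist// lee_fin ler_pM2r ?invr_gt0//.
apply: projection_contraction => //.
- exact: FG AG.
- exact: FG A'G'.
- exact: F'G' AG.
- exact: F'G' A'G'.
Qed.

Theorem proposition3p1 (R : realType) (d : measure_display)
    (Omega : measurableType d) (P : probability Omega R)
    (F PF : Omega -> R * R -> R * R)
    (F_meas : jointly_measurable F)
    (F_Hdiv : {ae P, forall w, Hdiv (F w)})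
    (F_moment2 : {ae torus_measure R, forall x,
       ('E_P[(fun w => enorm (F w x) ^+ 2)%R] < +oo)%E})
    (PF_meas : jointly_measurable PF)
    (PF_proj : {ae P, forall w, is_grad_projection (F w) (PF w)}) :
  (\int[torus_measure R]_x var_field P PF x
    <= \int[torus_measure R]_x var_field P F x)%E.
Proof.
have e0 (G : Omega -> R * R -> R * R) w w' :
    (0 <= \int[torus_measure R]_x (half_sqdist (G w x) (G w' x))%:E)%E.
  by apply: integral_ge0 => x _; rewrite lee_fin half_sqdist_ge0.
have mPF := measurable_integral_half_sqdist PF_meas.
have mF := measurable_integral_half_sqdist F_meas.
(* An almost sure inequality in each of the two variables separately suffices:
   the iterated integrals are compared one at a time. *)
rewrite (total_var_indep_copy P PF_meas) (total_var_indep_copy P F_meas).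
apply: ae_ge0_le_integral => //.
- by move=> w _; exact: integral_ge0.
- exact: (measurable_fun_fubini_tonelli_F (m2 := P) _ mPF).
- by move=> w _; exact: integral_ge0.
- exact: (measurable_fun_fubini_tonelli_F (m2 := P) _ mF).
apply: filterS2 (F_Hdiv) (PF_proj) => w Fw PFw _.
apply: ae_ge0_le_integral => //.
- exact: (measurableT_comp mPF (pair1_measurable w)).
- exact: (measurableT_comp mF (pair1_measurable w)).
apply: filterS2 (F_Hdiv) (PF_proj) => w' Fw' PFw' _.
exact: grad_projection_contraction.
Qed.
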